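(* Let $(X,\mathcal U)$ be a quasi-uniform space whose quasi-uniformity is generated by an $F$-quasi-gauge $D$ (i.e. $\mathcal U=\mathcal U_D$), and let $f:X\to\mathbb R\cup\{\infty\}$. Suppose that $(X,\mathcal U)$ is sequentially right $K$-complete, the topology $\tau(\mathcal U)$ is $T_1$, and $f$ is proper, bounded below and sequentially $\mathcal U$-lsc. Then for every $x_0\in\operatorname{dom} f$ there exists $z\in X$ such that (i) for all $d\in D$, $f(z)+d(z,x_0)\le f(x_0)$; and (ii) for every $x\in X\setminus\{z\}$ there exists $d_x\in D$ such that $f(z)<f(x)+d_x(x,z)$.
   Context: A quasi-uniformity on a set $X$ is a nonempty family $\mathcal U$ of subsets of $X\times X$ which contain the diagonal, closed under supersets and finite intersections, such that for every $U\in\mathcal U$ there is $V\in\mathcal U$ with $V\circ V\subseteq U$, where $M\circ N=\{(x,z):\exists y,\ (x,y)\in M,\ (y,z)\in N\}$. The topology $\tau(\mathcal U)$ has $\{U(x):U\in\mathcal U\}$, $U(x)=\{y\in X:(x,y)\in U\}$, as neighborhood basis at $x$. An $F$-quasi-gauge on $X$ is a family $D$ of functions $d:X\times X\to\mathbb R$ such that: (QF1) $D$ is directed upward (for the pointwise order); (QF2) $d(x,y)\ge 0$ and $d(x,x)=0$ for all $d\in D$, $x,y\in X$; (QF3) for every $d\in D$ there is $d'\in D$ with $d'\ge d$ such that $d(x,y)\le d'(x,z)+d'(z,y)$ for all $x,y,z\in X$. It generates the quasi-uniformity $\mathcal U_D$ having as basis the sets $V_{d,\varepsilon}=\{(x,y)\in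 X\times X: d(x,y)<\varepsilon\}$, $d\in D$, $\varepsilon>0$. A sequence $(x_n)$ is right $K$-Cauchy if for every $U\in\mathcal U$ there is $n_U\in\mathbb N$ such that $(x_{n+k},x_n)\in U$ for all $n\ge n_U$ and all $k\in\mathbb N$. $(X,\mathcal U)$ is sequentially right $K$-complete if every right $K$-Cauchy sequence is $\tau(\mathcal U)$-convergent to some point of $X$. $f$ is sequentially $\mathcal U$-lsc if $f(x)\le\liminf_n f(x_n)$ whenever $(x_n)$ is a sequence $\tau(\mathcal U)$-convergent to $x$. $\operatorname{dom} f=\{x: f(x)<\infty\}$; $f$ is proper if $\operatorname{dom} f\neq\emptyset$. *)

(* Defs.v *)
From HB Require Import structures.
From mathcomp Require Import all_boot all_order all_algebra.
From mathcomp Require Import all_classical all_reals all_analysis.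

Set Implicit Arguments.
Unset Strict Implicit.
Unset Printing Implicit Defensive.

Import Order.TTheory GRing.Theory Num.Theory.

Local Open Scope classical_set_scope.
Local Open Scope ring_scope.
Local Open Scope relation_scope.

(* Same axioms as [Nbhs_isUniform_mixin] of MathComp-Analysis, without the
   symmetry axiom [entourage_inv]. [Filter] does not require properness: it
   says that the family contains [setT] and is closed under binary
   intersections and supersets. As [xsection U x] is [set y | U (x, y)], the
   field [qnbhsE] says that the topology is tau(U). *)
HB.mixin Record Nbhs_isQuasiUniform_mixin M & Nbhs M := {
  qentourage : set_system (M * M);
  qentourage_filter : Filter qentourage;
  qentourage_diagonal : forall A, qentourage A -> diagonal `<=` A;
  qentourage_split_ex :
    forall A, qentourage A -> exists2 B, qentourage B & B \; B `<=` A;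
  qnbhsE : nbhs = nbhs_ qentourage;
}.

#[short(type="quasiUniformType")]
HB.structure Definition QuasiUniform :=
  {T of Topological T & Nbhs_isQuasiUniform_mixin T}.

(* Every quasi-uniformity on a choice type yields a [quasiUniformType]. *)
HB.factory Record isQuasiUniform M & Choice M := {
  qentourage : set_system (M * M);
  qentourage_filter : Filter qentourage;
  qentourage_diagonal : forall A, qentourage A -> diagonal `<=` A;
  qentourage_split_ex :
    forall A, qentourage A -> exists2 B, qentourage B & B \; B `<=` A;
}.

Local Close Scope relation_scope.

HB.builders Context M & isQuasiUniform M.

HB.instance Definition _ := @hasNbhs.Build M (nbhs_ qentourage).

Let nbhs_filter (p : M) : ProperFilter (nbhs p).
Proof.
apply: (@filter_from_proper _ _ qentourage (fun A => xsection A p)).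
  apply: filter_from_filter.
    by exists setT; exact: @filterT qentourage_filter.
  move=> A B entA entB; exists (A `&` B); last by rewrite xsectionI.
  exact: (@filterI _ _ qentourage_filter).
by move=> A entA; exists p; apply/mem_set; apply: qentourage_diagonal entA _ _.
Qed.

Let nbhs_singleton (p : M) A : nbhs p A -> A p.
Proof.
move=> [B entB sBpA].
by apply/sBpA/mem_set; exact: qentourage_diagonal entB _ _.
Qed.

Let nbhs_nbhs (p : M) A : nbhs p A -> nbhs p (nbhs^~ A).
Proof.
move=> [B entB sBpA].
have /qentourage_split_ex[C entC sC2B] := entB.
exists C => // q Cpq; exists C => // r Cqr.
by apply/sBpA/mem_set/sC2B; exists q; exact/set_mem.
Qed.

HB.instance Definition _ := Nbhs_isNbhsTopological.Build M
  nbhs_filter nbhs_singleton nbhs_nbhs.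

HB.instance Definition _ := Nbhs_isQuasiUniform_mixin.Build M
  qentourage_filter qentourage_diagonal qentourage_split_ex erefl.

HB.end.

Definition F_quasi_gauge (R : realType) (X : Type)
    (D : set (X -> X -> R)) : Prop :=
  [/\ forall d1 d2, D d1 -> D d2 ->
        exists2 d, D d & forall x y, d1 x y <= d x y /\ d2 x y <= d x y,
      forall d, D d -> forall x y, 0 <= d x y /\ d x x = 0
    & forall d, D d -> exists d',
        [/\ D d', forall x y, d x y <= d' x y
          & forall x y z, d x y <= d' x z + d' z y]].

Definition gauge_entourage (R : realType) (X : Type)
    (D : set (X -> X -> R)) : set_system (X * X) :=
  filter_from [set de : (X -> X -> R) * R | D de.1 /\ 0 < de.2]
    (fun de => [set xy | de.1 xy.1 xy.2 < de.2]).

Definition right_K_cauchy (X : quasiUniformType) (x_ : nat -> X) : Prop :=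
  forall U : set (X * X), qentourage U ->
    exists N : nat, forall n : nat, (N <= n)%N ->
      forall k : nat, U (x_ (n + k)%N, x_ n).

Definition seq_right_K_complete (X : quasiUniformType) : Prop :=
  forall x_ : nat -> X, right_K_cauchy x_ -> exists x : X, x_ @ \oo --> x.

Definition seq_lsc (R : realType) (X : topologicalType)
    (f : X -> \bar R) : Prop :=
  forall (x : X) (x_ : nat -> X), x_ @ \oo --> x ->
    (f x <= limn_einf (f \o x_))%E.

Definition edom (R : realType) (X : Type) (f : X -> \bar R) : set X :=
  [set x | (f x < +oo)%E].

(* Main.v *)
Require Import Defs.
From HB Require Import structures.
From mathcomp Require Import all_boot all_order all_algebra.
From mathcomp Require Import all_classical all_reals all_analysis.

Set Implicit Arguments.
Unset Strict Implicit.
Unset Printing Implicit Defensive.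

Local Open Scope classical_set_scope.
Local Open Scope ring_scope.

(** The proof is the descent argument for Ekeland's principle, run for the
    preorder in which [y] lies below [x] when [f y + d y x <= f x] for all [d]
    of the gauge at once ([gauge_le]). Transitivity is exactly what (QF3)
    provides: the loss from [d] to [d'] is harmless because the preorder
    quantifies over the whole gauge.

    Starting from [x0], choose a descending sequence in which [x_ n.+1] almost
    minimizes [f] among the points below [x_ n] ([almost_minimizing_descent]).
    A sequence suffices even for an uncountable [D]: along the descent every
    distance [d (x_ (n + k)) (x_ n)] is bounded, uniformly in [d], by the drop
    of [f], so that boundedness of [f] from below makes the sequence right
    K-Cauchy ([descending_right_K_cauchy]). Let [z] be a limit. By lower
    semicontinuity [f z <= f (x_ n)] for all [n], and the triangle inequality
    (QF3) upgrades this to [z] lying below every [x_ n]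
    ([limit_gauge_le]); for [n = 0] this is (i).

    If (ii) fails at [x], then [x] lies below [z], hence below every [x_ n],
    and the almost minimality of [x_ n.+1] forces [f z <= f x]. Then
    [f x + d x z <= f z] leaves only [d x z = 0] for all [d], that is, [z]
    belongs to every neighborhood of [x]; as the topology is T1, [x = z]. *)

Import Order.TTheory GRing.Theory Num.Theory.

(** Stated in the extended reals, so that it is a preorder on the whole space
    and not only on the domain of [f]. *)
Definition gauge_le (R : realType) (X : Type) (D : set (X -> X -> R))
    (f : X -> \bar R) (y x : X) : Prop :=
  forall d, D d -> (f y + (d y x)%:E <= f x)%E.

Lemma gauge_le_refl (R : realType) (X : Type) (D : set (X -> X -> R))
    (f : X -> \bar R) (x : X) : F_quasi_gauge D -> gauge_le D f x x.
Proof. by move=> [_ D0 _] d /D0/(_ x x)[_ ->]; rewrite adde0. Qed.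

(** For [d] take [d'] from (QF3) and apply both hypotheses to [d']. *)
Lemma gauge_le_trans (R : realType) (X : Type) (D : set (X -> X -> R))
    (f : X -> \bar R) (y x z : X) : F_quasi_gauge D ->
  gauge_le D f x y -> gauge_le D f y z -> gauge_le D f x z.
Proof.
move=> [_ _ Dtri] xy yz d /Dtri[d' [Dd' _ tri]].
apply: le_trans (yz _ Dd'); apply: le_trans (leeD2r _ (xy _ Dd')).
by rewrite -addeA leeD2l// -EFinD lee_fin.
Qed.

Lemma gauge_le_homo (R : realType) (X : Type) (D : set (X -> X -> R))
    (f : X -> \bar R) (y x : X) : F_quasi_gauge D -> D !=set0 ->
  gauge_le D f y x -> (f y <= f x)%E.
Proof.
move=> [_ D0 _] [d Dd] /(_ _ Dd); apply: le_trans.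
by rewrite leeDl// lee_fin; have [] := D0 _ Dd y x.
Qed.

Lemma almost_minimizer (R : realType) (T : Type) (f : T -> \bar R)
    (S : set T) (m e : R) : S !=set0 -> (forall x, m%:E <= f x)%E -> 0 < e ->
  exists2 y, S y & forall w, S w -> (f y <= f w + e%:E)%E.
Proof.
move=> [x Sx] fm e0.
have infle w : S w -> (ereal_inf (f @` S) <= f w)%E.
  by move=> Sw; apply: ereal_inf_lbound; exists w.
have infm : (m%:E <= ereal_inf (f @` S))%E.
  by apply: le_ereal_inf_tmp => _ [w _ <-].
(* An infimum +oo admits no adherent value, but then any point will do. *)
have [infoo|] := eqVneq (ereal_inf (f @` S)) +oo%E.
  exists x => // w /infle.
  by rewrite infoo leye_eq => /eqP ->; rewrite addye ?leey.
rewrite -ltey => infoo.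
have inffin : ereal_inf (f @` S) \is a fin_num.
  by rewrite fin_real// infoo (lt_le_trans _ infm)// ltNyr.
have [_ [y Sy <-] fy] := lb_ereal_inf_adherent e0 inffin.
by exists y => // w /infle fw; apply: (le_trans (ltW fy)); rewrite leeD2r.
Qed.

(** The tolerance [1 / n.+1] tends to 0, so that a point below all the [x_ n]
    has a value at least the infimum of the [f (x_ n)]. *)
Lemma almost_minimizing_descent (R : realType) (T : Type)
    (le : T -> T -> Prop) (f : T -> \bar R) (m : R) (x0 : T) :
  (forall x, le x x) -> (forall x, m%:E <= f x)%E ->
  exists x_ : nat -> T, [/\ x_ 0%N = x0, forall n, le (x_ n.+1) (x_ n) &
    forall n w, le w (x_ n) -> (f (x_ n.+1) <= f w + n.+1%:R^-1%:E)%E].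
Proof.
move=> lexx fm.
have /choice[next nextP] (nx : nat * T) : exists y, le y nx.2 /\
    forall w, le w nx.2 -> (f y <= f w + nx.1.+1%:R^-1%:E)%E.
  have [||y ? ?] := @almost_minimizer _ _ f [set y | le y nx.2] m
    nx.1.+1%:R^-1 _ fm.
  - by exists nx.2; exact: lexx.
  - by rewrite invr_gt0.
  - by exists y.
pose x_ := nat_rect (fun=> T) x0 (fun n x => next (n, x)).
by exists x_; split=> // n; have [] := nextP (n, x_ n).
Qed.

Lemma gauge_le_chain (R : realType) (X : Type) (D : set (X -> X -> R))
    (f : X -> \bar R) (x_ : nat -> X) : F_quasi_gauge D ->
  (forall n, gauge_le D f (x_ n.+1) (x_ n)) ->
  forall n k, gauge_le D f (x_ (n + k)%N) (x_ n).
Proof.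
move=> DF desc n; elim=> [|k IH]; first by rewrite addn0; exact: gauge_le_refl.
by rewrite addnS; exact: gauge_le_trans (desc _) IH.
Qed.

(** Every term is below the first, so the values [f (x_ n)] are real and
    decrease to a real infimum; past the point where they are within [e] of
    it, [d (x_ (n + k)) (x_ n) <= f (x_ n) - f (x_ (n + k)) < e] for all [d]
    simultaneously. *)
Lemma descending_right_K_cauchy (R : realType) (X : quasiUniformType)
    (D : set (X -> X -> R)) (f : X -> \bar R) (m : R) (x_ : nat -> X) :
  F_quasi_gauge D -> @qentourage X = gauge_entourage D ->
  (forall x, m%:E <= f x)%E -> edom f (x_ 0%N) ->
  (forall n, gauge_le D f (x_ n.+1) (x_ n)) -> right_K_cauchy x_.
Proof.
move=> DF Dgen fm f0 /(gauge_le_chain DF) chain U.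
rewrite Dgen => -[[d e] [/= Dd e0] deU].
have D0 : D !=set0 by exists d.
have ffin n : f (x_ n) \is a fin_num.
  rewrite fin_real// (lt_le_trans _ (fm _)) ?ltNyr//=.
  by apply: le_lt_trans f0; exact: gauge_le_homo DF D0 (chain 0%N n).
have [N] : exists N, (f (x_ N) < ereal_inf (range (f \o x_)) + e%:E)%E.
  have inffin : ereal_inf (range (f \o x_)) \is a fin_num.
    rewrite fin_real//; apply/andP; split.
      apply: (lt_le_trans (ltNyr m)).
      by apply: le_ereal_inf_tmp => _ [n _ <-]; exact: fm.
    by apply: le_lt_trans f0; apply: ereal_inf_lbound; exists 0%N.
  by have [_ [N _ <-]] := lb_ereal_inf_adherent e0 inffin; exists N.
move=> fN; exists N => n Nn k; apply: deU => /=.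
have fn : (f (x_ n) <= f (x_ N))%E.
  by rewrite -(subnKC Nn); exact: gauge_le_homo DF D0 (chain _ _).
have fnk : (ereal_inf (range (f \o x_)) <= f (x_ (n + k)%N))%E.
  by apply: ereal_inf_lbound; exists (n + k)%N.
have := le_lt_trans (chain n k _ Dd)
  (le_lt_trans fn (lt_le_trans fN (leeD2r e%:E fnk))).
by rewrite lteD2lE ?ffin// lte_fin.
Qed.

(** Convergence to [z] makes [d' z (x_ p)] small for late [p], while
    [d' (x_ p) (x_ n)] is controlled by the descent; (QF3) adds the two. *)
Lemma limit_gauge_le (R : realType) (X : quasiUniformType)
    (D : set (X -> X -> R)) (f : X -> \bar R) (x_ : nat -> X) (z : X) :
  F_quasi_gauge D -> @qentourage X = gauge_entourage D ->
  (forall n, gauge_le D f (x_ n.+1) (x_ n)) -> x_ @ \oo --> z ->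
  (forall n, f z <= f (x_ n))%E -> forall n, gauge_le D f z (x_ n).
Proof.
move=> DF Dgen /(gauge_le_chain DF) chain xz fz n d Dd.
have [_ _ /(_ _ Dd)[d' [Dd' _ tri]]] := DF.
apply/lee_addgt0Pr => e e0.
have : nbhs z [set y | d' z y < e].
  rewrite qnbhsE; exists [set xy | d' xy.1 xy.2 < e].
    by rewrite Dgen; exists (d', e).
  by move=> y /set_mem.
move=> /xz[N _ /(_ (n + N)%N) /= /(_ (leq_addl _ _)) small].
apply: (@le_trans _ _ (f (x_ (n + N)%N) + (e + d' (x_ (n + N)%N) (x_ n))%:E)%E).
  apply: leeD; rewrite ?fz// lee_fin.
  by rewrite (le_trans (tri _ _ (x_ (n + N)%N)))// lerD2r ltW.
by rewrite EFinD addeCA addeC leeD2r//; exact: chain.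
Qed.

(** Lower semicontinuity bounds [f z] by the liminf, which for nonincreasing
    values is their infimum. *)
Lemma seq_lsc_nonincreasing (R : realType) (X : topologicalType)
    (f : X -> \bar R) (x_ : nat -> X) (z : X) : seq_lsc f ->
  {homo f \o x_ : n p / (n <= p)%N >-> (p <= n)%E} -> x_ @ \oo --> z ->
  forall n, (f z <= f (x_ n))%E.
Proof.
move=> lsc mono /lsc fz n; apply: (le_trans fz).
have cvgf := ereal_nonincreasing_cvgn mono.
rewrite is_cvg_limn_einfE; last by apply/cvg_ex; eexists; exact: cvgf.
by rewrite (cvg_lim _ cvgf)//; apply: ereal_inf_lbound; exists n.
Qed.

(** Every neighborhood of [x] contains a set [d x y < e] with [e > 0], hence
    [z]; in a T1 space this excludes [x != z]. *)
Lemma gauge0_eq (R : realType) (X : quasiUniformType)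
    (D : set (X -> X -> R)) (x z : X) :
  @qentourage X = gauge_entourage D -> accessible_space X ->
  (forall d, D d -> d x z <= 0) -> x = z.
Proof.
move=> Dgen T1 xz0; apply/eqP/negP => /negP /T1[A [oA xA zA]].
have : nbhs x A by apply: open_nbhs_nbhs; split=> //; exact: set_mem.
rewrite qnbhsE => -[U]; rewrite Dgen => -[[d e] [/= Dd e0] deU] UA.
move: zA; rewrite inE; apply; apply/UA/mem_set/deU => /=.
exact: le_lt_trans (xz0 _ Dd) e0.
Qed.

Theorem corollary4p8 (R : realType) (X : quasiUniformType)
    (D : set (X -> X -> R)) (f : X -> \bar R)
    (D_gauge : F_quasi_gauge D)
    (D_gen : @qentourage X = gauge_entourage D)
    (f_codom : forall x, f x != -oo%E)
    (X_complete : seq_right_K_complete X)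
    (X_T1 : accessible_space X)
    (f_proper : edom f !=set0)
    (f_lb : exists m : R, forall x, (m%:E <= f x)%E)
    (f_lsc : seq_lsc f) :
  forall x0, edom f x0 ->
    exists z : X,
      (forall d, D d -> (f z + (d z x0)%:E <= f x0)%E) /\
      (forall x, x <> z ->
        exists2 dx, D dx & (f z < f x + (dx x z)%:E)%E).
Proof.
move=> x0 fx0; have [m fm] := f_lb.
(* The whole of X * X is an entourage, which rules out an empty gauge. *)
have D0 : D !=set0.
  have := @filterT _ _ (@qentourage_filter X).
  by rewrite D_gen => -[[d e] [/= Dd _] _]; exists d.
have [x_ [x_0 desc amin]] := almost_minimizing_descent x0
  (fun x => gauge_le_refl f x D_gauge) fm.
have mono : {homo f \o x_ : n p / (n <= p)%N >-> (p <= n)%E}.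
  move=> n p np /=; rewrite -(subnKC np).
  exact: gauge_le_homo D_gauge D0 (gauge_le_chain D_gauge desc _ _).
have fx_0 : edom f (x_ 0%N) by rewrite x_0.
have [z xz] := X_complete _
  (descending_right_K_cauchy D_gauge D_gen fm fx_0 desc).
have fz := seq_lsc_nonincreasing f_lsc mono xz.
have zle := limit_gauge_le D_gauge D_gen desc xz fz.
exists z; split; first by have := zle 0%N; rewrite x_0.
move=> x xNz; apply: contrapT => noD; apply: xNz.
have xlez : gauge_le D f x z.
  by move=> d Dd; rewrite leNgt; apply/negP => ?; apply: noD; exists d.
have fzx : (f z <= f x)%E.
  apply/lee_addgt0Pr => e e0.
  have [n _ /(_ n (leqnn _)) ne] := near_infty_natSinv_lt (PosNum e0).
  apply: (le_trans (fz n.+1)).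
  apply: (le_trans (amin _ _ (gauge_le_trans D_gauge xlez (zle n)))).
  by rewrite leeD2l// lee_fin ltW.
have fxfin : f x \is a fin_num.
  rewrite fin_real// (lt_le_trans _ (fm _)) ?ltNyr//=.
  apply: (le_lt_trans (gauge_le_homo D_gauge D0 xlez)).
  by apply: (le_lt_trans (fz 0%N)).
apply: gauge0_eq D_gen X_T1 _ => d Dd.
have := le_trans (xlez _ Dd) fzx.
by rewrite -[leRHS]adde0 leeD2lE// lee_fin.
Qed.
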